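(* Let $m,n,k \in \mathbb{N}$. Then $P^{*}_{DP}(K_{m,n},k) = P(K_{m,n},k)$.
   Context: All graphs are finite, simple, and nonempty (at least one vertex). $\mathbb{N}$ denotes the set of positive integers and $[k]=\{1,\ldots,k\}$. $K_{m,n}$ is the complete bipartite graph with partite sets of sizes $m$ and $n$. $P(G,k)$ denotes the number of proper $k$-colorings of $G$, i.e. functions $f: V(G) \to [k]$ with $f(u) \neq f(v)$ whenever $uv \in E(G)$. For a graph $H$ and $S_1,S_2 \subseteq V(H)$, $E_H(S_1,S_2)$ is the set of edges of $H$ with one endpoint in $S_1$ and the other in $S_2$. A (DP-)cover of a graph $G$ is a pair $\mathcal{H} = (L,H)$, where $H$ is a graph and $L: V(G) \to 2^{V(H)}$ is a function such that: (1) $\{L(v) : v \in V(G)\}$ is a partition of $V(H)$ of size $|V(G)|$; (2) for every $v \in V(G)$, the induced subgraph $H[L(v)]$ is complete; (3) if $E_H(L(u),L(v))$ is nonempty, then $u=v$ or $uv \in E(G)$; (4) if $uv \in E(G)$, then $E_H(L(u),L(v))$ is a (possibly empty) matching. The cover is $k$-fold if $|L(v)| = k$ for every $v \in V(G)$, and a $k$-fold cover is full if $|E_H(L(u),L(v))| = k$ for every $uv \in E(G)$. An $\mathcal{H}$-coloring of $G$ is an independent set in $H$ of size $|V(G)|$. The dual DP color function $P^{*}_{DP}(G,k)$ is the maximum number of $\mathcal{H}$-colorings of $G$ over all full $k$-fold covers $\mathcal{H}$ of $G$. *)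

(* Defs.v *)
(* MathComp; classical_sets is used only for the choice operator xget. It comes
   before all_boot so that partition, trivIset, set0, etc. are those of finset. *)
From mathcomp Require Import boolp classical_sets.
From mathcomp Require Import all_boot.

Set Implicit Arguments.
Unset Strict Implicit.
Unset Printing Implicit Defensive.

Local Open Scope nat_scope.
Local Open Scope set_scope.

(* Finite simple graphs. Nonemptiness is not a field: for m, n, k > 0 the graph
   K_{m,n} and the graph H of any k-fold cover of it are nonempty anyway. *)
Record sgraph := SGraph {
  vert :> finType;
  adj : rel vert;
  adj_sym : symmetric adj;
  adj_irr : irreflexive adj }.

Section Graph.
Variable G : sgraph.

Definition edges : {set {set G}} :=
  [set e | [exists x : G, exists y : G, adj x y && (e == [set x; y])]].

Definition edges_between (S1 S2 : {set G}) : {set {set G}} :=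
  [set e in edges | [exists x in S1, exists y in S2, e == [set x; y]]].

(* The edges of M are pairwise disjoint. *)
Definition is_matching (M : {set {set G}}) : bool := trivIset M.

Definition is_complete (S : {set G}) : Prop :=
  {in S &, forall x y, x != y -> adj x y}.

Definition independent (S : {set G}) : bool :=
  [forall x in S, forall y in S, ~~ adj x y].

Definition proper_coloring k (f : {ffun G -> 'I_k}) : bool :=
  [forall u, forall v, adj u v ==> (f u != f v)].

Definition chrom_count (k : nat) : nat :=
  #|[set f : {ffun G -> 'I_k} | proper_coloring f]|.

End Graph.

Record cover (G : sgraph) := Cover {
  cgraph : sgraph;
  clist : G -> {set cgraph};
  (* as u |-> L(u) ranges over V(G), the parts are nonempty (cf. partition)
     and, by the cardinality condition, pairwise distinct *)
  cover_partition : partition [set clist v | v : G] [set: cgraph];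
  cover_size : #|[set clist v | v : G]| = #|G|;
  cover_complete : forall v, is_complete (clist v);
  cover_edges : forall u v,
    edges_between (clist u) (clist v) != set0 -> u = v \/ adj u v;
  cover_matching : forall u v,
    adj u v -> is_matching (edges_between (clist u) (clist v)) }.

Section DPColoring.
Variable G : sgraph.

Definition fold (k : nat) (H : cover G) : Prop :=
  forall v, #|clist H v| = k.

Definition full_fold (k : nat) (H : cover G) : Prop :=
  fold k H /\
  forall u v, adj u v -> #|edges_between (clist H u) (clist H v)| = k.

Definition cover_colorings (H : cover G) : {set {set cgraph H}} :=
  [set I : {set cgraph H} | independent I & #|I| == #|G|].

Definition full_fold_counts (k : nat) : set nat :=
  fun N => exists2 H : cover G, full_fold k H & #|cover_colorings H| = N.

End DPColoring.

Definition is_maximum (A : set nat) (N : nat) : Prop :=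
  A N /\ forall M, A M -> M <= N.

(* The default value 0 is never used when k > 0, see dual_DPP. *)
Definition dual_DP (G : sgraph) (k : nat) : nat :=
  xget 0 (is_maximum (full_fold_counts G k)).

Section CompleteBipartite.
Variables m n : nat.

Definition Kmn_adj : rel ('I_m + 'I_n)%type := fun x y =>
  match x, y with
  | inl _, inr _ | inr _, inl _ => true
  | _, _ => false
  end.

Lemma Kmn_sym : symmetric Kmn_adj. Proof. by case=> ? []. Qed.
Lemma Kmn_irr : irreflexive Kmn_adj. Proof. by case. Qed.

Definition Kmn : sgraph := SGraph Kmn_sym Kmn_irr.

End CompleteBipartite.

(* The maximum defining dual_DP is attained when k > 0. *)
Section Existence.
Variables (G : sgraph) (k : nat).

Definition std_adj : rel (G * 'I_k)%type := fun x y =>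
  ((x.1 == y.1) && (x.2 != y.2)) || (adj x.1 y.1 && (x.2 == y.2)).

Lemma std_sym : symmetric std_adj.
Proof.
by move=> x y; rewrite /std_adj adj_sym (eq_sym y.1) (eq_sym y.2).
Qed.

Lemma std_irr : irreflexive std_adj.
Proof. by move=> x; rewrite /std_adj !eqxx adj_irr. Qed.

Definition std_graph : sgraph := SGraph std_sym std_irr.

Definition std_list (v : G) : {set std_graph} :=
  [set x : std_graph | (x : G * 'I_k).1 == v].

Lemma std_listE v (x : std_graph) :
  (x \in std_list v) = ((x : G * 'I_k).1 == v).
Proof. by rewrite inE. Qed.

Lemma std_fold v : #|std_list v| = k.
Proof.
rewrite -[RHS]card_ord -(card_imset predT (f := fun i => (v, i) : G * 'I_k));
  last by move=> i j [].
apply: eq_card => -[u i]; rewrite std_listE /=; apply/eqP/imsetP => [->|].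
  by exists i.
by case=> j _ [].
Qed.

Hypothesis k_gt0 : 0 < k.

Lemma std_list_inj : injective std_list.
Proof.
move=> u v uv; apply/eqP.
by rewrite -(std_listE v ((u, Ordinal k_gt0) : std_graph)) -uv std_listE.
Qed.

Lemma std_size : #|[set std_list v | v : G]| = #|G|.
Proof. exact: card_imset std_list_inj. Qed.

Lemma std_partition : partition [set std_list v | v : G] [set: std_graph].
Proof.
apply/and3P; split.
- rewrite eqEsubset subsetT /=; apply/subsetP => x _; apply/bigcupP.
  exists (std_list (x : G * 'I_k).1); last by rewrite std_listE.
  exact: imset_f.
- apply/trivIsetP => _ _ /imsetP[u _ ->] /imsetP[v _ ->] uv.
  rewrite -setI_eq0; apply/eqP/setP => x; rewrite !inE.
  by apply/andP => -[/eqP-> /eqP E]; rewrite E eqxx in uv.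
- apply/imsetP => -[v _ /esym v0].
  by move: k_gt0; rewrite -(std_fold v) v0 cards0.
Qed.

Lemma std_complete v : is_complete (std_list v).
Proof.
move=> [u i] [w j]; rewrite !std_listE /= => /eqP-> /eqP->.
by rewrite /adj /= /std_adj /= xpair_eqE eqxx /= => ->.
Qed.

Lemma set2_eq (T : finType) (x y a b : T) : [set x; y] = [set a; b] ->
  (x = a /\ y = b) \/ (x = b /\ y = a).
Proof.
move=> E.
have: x \in [set a; b] by rewrite -E set21.
have: y \in [set a; b] by rewrite -E set22.
have: a \in [set x; y] by rewrite E set21.
have: b \in [set x; y] by rewrite E set22.
by rewrite !inE => /orP[]/eqP-> /orP[]/eqP-> /orP[]/eqP ? /orP[]/eqP ?;
  subst; auto.
Qed.

Lemma std_betweenP u v (e : {set std_graph}) :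
  reflect (exists i j, (u == v) && (i != j) || adj u v && (i == j) /\
             e = [set ((u, i) : std_graph); ((v, j) : std_graph)])
          (e \in edges_between (std_list u) (std_list v)).
Proof.
apply: (iffP idP).
  rewrite !inE => /andP[/existsP[x /existsP[y /andP[xy /eqP ->]]]].
  case/existsP=> -[a i] /andP[]; rewrite std_listE /= => /eqP->.
  case/existsP=> -[b j] /andP[]; rewrite std_listE /= => /eqP-> /eqP E.
  exists i, j; split=> //.
  suff : adj ((u, i) : std_graph) ((v, j) : std_graph) by [].
  by case: (set2_eq E) => -[<- <-] //; rewrite adj_sym.
case=> i [j [ij ->]]; rewrite !inE; apply/andP; split.
  by apply/existsP; exists (u, i); apply/existsP; exists (v, j);
     rewrite eqxx andbT.
apply/existsP; exists (u, i); rewrite std_listE eqxx /=.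
by apply/existsP; exists (v, j); rewrite std_listE !eqxx.
Qed.

Lemma std_edges u v :
  edges_between (std_list u) (std_list v) != set0 -> u = v \/ adj u v.
Proof.
case/set0Pn=> e /std_betweenP[i [j [/orP[]/andP[uv _] _]]]; last by right.
by left; apply/eqP.
Qed.

Lemma adj_neq (u v : G) : adj u v -> (u == v) = false.
Proof. by move=> uv; apply/eqP => E; rewrite E adj_irr in uv. Qed.

Lemma std_between_adj u v : adj u v ->
  edges_between (std_list u) (std_list v) =
  [set [set ((u, i) : std_graph); ((v, i) : std_graph)] | i : 'I_k].
Proof.
move=> uv; apply/setP => e; apply/std_betweenP/imsetP.
  by case=> i [j []]; rewrite (adj_neq uv) uv /= => /eqP<- ->; exists i.
by case=> i _ ->; exists i, i; rewrite uv eqxx orbT.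
Qed.

Lemma std_matching u v : adj u v ->
  is_matching (edges_between (std_list u) (std_list v)).
Proof.
move=> uv; rewrite std_between_adj //.
apply/trivIsetP => _ _ /imsetP[i _ ->] /imsetP[j _ ->] ij.
have {}ij : (i == j) = false by apply/eqP => E; rewrite E eqxx in ij.
rewrite -setI_eq0; apply/eqP/setP => -[w l]; rewrite !inE !xpair_eqE.
apply/andP => -[/orP[]/andP[_ /eqP->]]; by rewrite ij !andbF.
Qed.

Definition std_cover : cover G :=
  Cover std_partition std_size std_complete std_edges std_matching.

Lemma std_full : full_fold k std_cover.
Proof.
split=> [v|u v uv]; first exact: std_fold.
rewrite /= std_between_adj // card_imset ?card_ord // => i j.
by case/set2_eq=> [[[] //]|[[]]] _ _ [].
Qed.

Lemma card_fold (H : cover G) : fold k H -> #|cgraph H| = #|G| * k.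
Proof.
move=> fH; rewrite -cardsT (card_uniform_partition (n := k) _ (cover_partition H)) //.
  by rewrite cover_size.
by move=> _ /imsetP[v _ ->].
Qed.

Lemma dual_DPP : is_maximum (full_fold_counts G k) (dual_DP G k).
Proof.
apply: xgetPex.
pose P N := `[< full_fold_counts G k N >].
have exP : exists N, P N.
  by exists #|cover_colorings std_cover|; apply/asboolP;
     exists std_cover => //; exact: std_full.
have leP N : P N -> N <= 2 ^ (#|G| * k).
  move=> /asboolP[H [fH _] <-].
  by rewrite -(card_fold fH) -cardsT -card_powerset subset_leq_card //;
     apply/subsetP => I _; rewrite powersetE subsetT.
case: (ex_maxnP exP leP) => N /asboolP PN maxN; exists N; split=> // M PM.
by apply: maxN; apply/asboolP.
Qed.

End Existence.

(* Main.v *)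
Require Import Defs.
From mathcomp Require Import all_boot all_algebra.

(** Order the coloring of K_{m,n} so that the m left vertices come first. A
    proper k-coloring is a choice a of left colors together with, for each right
    vertex, one of the colors that a leaves unused, so
      P(K_{m,n}, k) = sum_a |unused a|^n.
    In a full k-fold cover, a coloring is likewise a transversal c of the left
    lists together with, for each right vertex j, a vertex of its list that is
    available, that is, has no neighbor in c; so the number of colorings is
      sum_c prod_j |avail c j|.

    Fix j. The perfect matchings between the list of j and the left lists
    transport a numbering of the list of j by 'I_k to every left list. In these
    coordinates avail c j is the set of unused colors, so
    sum_c |avail c j|^n = sum_a |unused a|^n for this j ([sum_avail_exp]). The
    coordinates depend on j, and different j may be incompatible with each
    other, but the AM-GM inequality n prod_j f_j <= sum_j f_j^n ([AGM_exp])
    separates the right vertices: summing it over c bounds n times the number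
    of colorings by n copies of P(K_{m,n}, k) ([card_cover_colorings_le]). The
    canonical cover, whose matchings join equal colors, attains the bound
    ([chrom_count_le_std]). *)

Set Implicit Arguments.
Unset Strict Implicit.
Unset Printing Implicit Defensive.

Local Open Scope nat_scope.

(** * Two counting tools *)

(** AM-GM applied to the numbers f_j^n, after taking n-th roots. *)
Lemma AGM_exp n (f : 'I_n -> nat) : 0 < n ->
  n * \prod_j f j <= \sum_j f j ^ n.
Proof.
move=> n0.
suff: (n * \prod_j f j) ^ n <= (\sum_j f j ^ n) ^ n by rewrite leq_exp2r.
have [+ _] := @Num.Theory.leif_AGM_scaled int 'I_n predT
  (fun j => (f j ^ n)%:R%R) (fun j _ => Num.Theory.mulrn_wge0 _ (Num.Theory.ler0n _ _)).
rewrite card_ord; under eq_bigr do rewrite -GRing.mulrnA.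
rewrite -GRing.natr_prod -GRing.natr_sum -GRing.natrX Num.Theory.ler_nat.
by rewrite big_split /= prod_nat_const card_ord mulnC expnMn (big_morph (expn^~ n) (fun x y => expnMn x y n) (exp1n n)).
Qed.

Lemma card_dep_pairs (A B : finType) (P : {pred A}) (Q : A -> {pred B}) :
  #|[set p : A * B | (p.1 \in P) && (p.2 \in Q p.1)]| = \sum_(a in P) #|Q a|.
Proof.
under eq_bigr do rewrite -sum1_card.
rewrite pair_big_dep /= sum1dep_card.
by apply: eq_card => p; rewrite !inE.
Qed.

Lemma card_ffun_family (J : finType) (T : finType) (S : J -> {set T}) :
  #|(family S : {pred {ffun J -> T}})| = \prod_j #|S j|.
Proof. by rewrite card_family foldrE big_map big_enum. Qed.

(** * Full covers *)

Section Covers.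
Variables (G : sgraph) (H : Defs.cover G) (k : nat).
Local Notation L := (clist H).

Lemma clist_ex (x : cgraph H) : exists v, x \in L v.
Proof.
have: x \in finset.cover [set L v | v : G].
  by rewrite (finset.cover_partition (Defs.cover_partition H)) inE.
by case/bigcupP=> _ /imsetP[v _ ->] xv; exists v.
Qed.

(** An independent set meets each list, a clique, at most once; having as many
    elements as there are lists, it meets each of them exactly once. *)
Lemma cover_coloring_transversal (I : {set cgraph H}) :
  I \in cover_colorings H ->
  exists2 g : G -> cgraph H, (forall v, g v \in L v) & I = [set g v | v : G].
Proof.
rewrite inE => /andP[/forall_inP indI /eqP cI].
have same v x y : x \in I -> y \in I -> x \in L v -> y \in L v -> x = y.
  move=> xI yI xv yv; apply/eqP; apply: contraT => xy.
  by have /forall_inP/(_ y yI) := indI x xI; rewrite (cover_complete xv yv xy).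
pose w x := xchoose (clist_ex x).
have wP x : x \in L (w x) by exact: (xchooseP (clist_ex x)).
have wI : w @: I = setT.
  apply/eqP; rewrite eqEcard subsetT cardsT -cI card_in_imset ?leqnn //.
  by move=> x y xI yI E; apply: (same (w x)) => //; rewrite E.
have meet v : exists x, (x \in I) && (x \in L v).
  have: v \in w @: I by rewrite wI.
  by case/imsetP=> x xI ->; exists x; rewrite xI wP.
pose g v := xchoose (meet v).
have gP v : (g v \in I) && (g v \in L v) by exact: (xchooseP (meet v)).
exists g => [v|]; first by case/andP: (gP v).
apply/setP => x; apply/idP/imsetP => [xI|[v _ ->]]; last by case/andP: (gP v).
by exists (w x) => //; case/andP: (gP (w x)) => gI gL; apply: (same (w x)).
Qed.

(** Orients an edge of the cover, an unordered pair, from the list of u to that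
    of v. *)
Lemma edges_betweenP u v (e : {set cgraph H}) :
  reflect (exists x y, [/\ x \in L u, y \in L v, adj x y & e = [set x; y]])
          (e \in edges_between (L u) (L v)).
Proof.
apply: (iffP idP); last first.
  case=> x [y [xu yv xy ->]]; rewrite !inE; apply/andP; split.
    by apply/existsP; exists x; apply/existsP; exists y; rewrite xy eqxx.
  by apply/exists_inP; exists x => //; apply/exists_inP; exists y.
rewrite !inE => /andP[/existsP[a /existsP[b /andP[ab /eqP->]]]].
case/exists_inP=> x xu /exists_inP[y yv /eqP E]; exists x, y; split=> //.
by case: (set2_eq E) ab => -[-> ->] //; rewrite adj_sym.
Qed.

Lemma partner_uniq u v x y z : adj u v ->
  x \in L u -> y \in L v -> z \in L v -> adj x y -> adj x z -> y = z.
Proof.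
move=> uv xu yv zv xy xz.
have /trivIsetP tI := @cover_matching G H u v uv.
have [|E] := eqVneq [set x; y] [set x; z].
  by case/set2_eq=> [[]|[<- ->]].
have xyE : [set x; y] \in edges_between (L u) (L v).
  by apply/edges_betweenP; exists x, y.
have xzE : [set x; z] \in edges_between (L u) (L v).
  by apply/edges_betweenP; exists x, z.
by move/disjoint_setI0: (tI _ _ xyE xzE E) => /setP/(_ x); rewrite !inE eqxx.
Qed.

(** A matching of k edges between two lists of size k is perfect: distinct edges
    have distinct endpoints in the list of u, so these endpoints are all of it. *)
Lemma partner_ex u v x : full_fold k H -> adj u v -> x \in L u ->
  exists2 y, y \in L v & adj x y.
Proof.
move=> [fH mH] uv xu.
pose S := [set x in L u | [exists y in L v, adj x y]].
pose edge x := [set x; odflt x [pick y in L v | adj x y]].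
(* Each edge of the matching is recovered by [edge] from its endpoint in S. *)
suff: S = L u.
  by move/setP/(_ x); rewrite !inE xu /= => /exists_inP.
apply/eqP; rewrite eqEcard fH -(mH _ _ uv); apply/andP; split.
  by apply/subsetP => z; rewrite inE => /andP[].
apply: leq_trans (leq_imset_card edge S); apply: subset_leq_card.
apply/subsetP => e /edges_betweenP[a [b [au bv ab ->]]].
apply/imsetP; exists a.
  by rewrite inE au; apply/exists_inP; exists b.
rewrite /edge; case: pickP => [c /andP[cv ac]|/(_ b)]; last by rewrite bv ab.
by rewrite (partner_uniq uv au bv cv ab ac).
Qed.

Lemma clist_enum v : fold k H ->
  exists2 e : 'I_k -> cgraph H, injective e & L v = [set e b | b : 'I_k].
Proof.
move=> /(_ v) fv; exists (fun b => enum_val (cast_ord (esym fv) b)).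
  by move=> a b /enum_val_inj/cast_ord_inj.
apply/setP => x; apply/idP/imsetP => [xv|[b _ ->]]; last exact: enum_valP.
exists (cast_ord fv (enum_rank_in xv x)) => //.
by rewrite cast_ordK enum_rankK_in.
Qed.

End Covers.

(** * Complete bipartite graphs *)

Section CompleteBipartite.
Variables m n k : nat.

Definition unused (a : {ffun 'I_m -> 'I_k}) : {set 'I_k} :=
  ~: [set a i | i : 'I_m].

(** Gluing left colors a to right colors taken from unused a is injective and
    always gives a proper coloring. *)
Lemma chrom_count_Kmn_ge :
  \sum_(a : {ffun 'I_m -> 'I_k}) #|unused a| ^ n <= chrom_count (Kmn m n) k.
Proof.
pose Q a : {pred {ffun 'I_n -> 'I_k}} := family (fun=> unused a).
have -> : \sum_a #|unused a| ^ n = \sum_(a in predT) #|Q a|.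
  by apply: eq_bigr => a _; rewrite card_ffun_family prod_nat_const card_ord.
rewrite -card_dep_pairs.
pose h (p : {ffun 'I_m -> 'I_k} * {ffun 'I_n -> 'I_k}) : {ffun Kmn m n -> 'I_k} :=
  [ffun v : Kmn m n => match v with inl i => p.1 i | inr j => p.2 j end].
have hI : injective h.
  move=> [a b] [a' b'] /ffunP E.
  congr pair; apply/ffunP => i.
    by have := E (inl i); rewrite !ffunE.
  by have := E (inr i); rewrite !ffunE.
rewrite -(card_imset _ hI); apply: subset_leq_card.
apply/subsetP => _ /imsetP[[a b] + ->]; rewrite !inE /= => /familyP bP.
have neq i j : a i != b j.
  by apply: contraTneq (bP j) => <-; rewrite inE negbK imset_f.
apply/forallP => -[i|j]; apply/forallP => -[i'|j']; rewrite !ffunE //=.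
by rewrite eq_sym.
Qed.

Variable H : Defs.cover (Kmn m n).
Local Notation L := (clist H).
Local Notation left_transversals :=
  (family (fun i => L (inl i)) : {pred {ffun 'I_m -> cgraph H}}).

Definition avail (c : {ffun 'I_m -> cgraph H}) (j : 'I_n) : {set cgraph H} :=
  [set y in L (inr j) | [forall i, ~~ adj (c i) y]].

Lemma card_cover_colorings_Kmn_le :
  #|cover_colorings H| <= \sum_(c in left_transversals) \prod_j #|avail c j|.
Proof.
under eq_bigr do rewrite -card_ffun_family.
rewrite -card_dep_pairs.
pose h (p : {ffun 'I_m -> cgraph H} * {ffun 'I_n -> cgraph H}) :=
  [set (match v with inl i => p.1 i | inr j => p.2 j end) | v : Kmn m n].
apply: leq_trans (leq_imset_card h _); apply: subset_leq_card.
apply/subsetP => I IH; have [g gL gI] := cover_coloring_transversal IH.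
apply/imsetP; exists ([ffun i => g (inl i)], [ffun j => g (inr j)]); last first.
  by rewrite gI; apply: eq_imset => -[i|j] /=; rewrite ffunE.
rewrite inE /=; apply/andP; split; first by apply/familyP => i; rewrite ffunE.
apply/familyP => j; rewrite ffunE inE gL /=; apply/forallP => i; rewrite ffunE.
move: IH; rewrite inE => /andP[/forall_inP + _].
have gvI v : g v \in I by rewrite gI imset_f.
by move=> /(_ _ (gvI (inl i)))/forall_inP/(_ _ (gvI (inr j))).
Qed.

(** The sum over c does not depend on the cover: a relabels c by sending left
    vertex i to the number of the partner of c i in the list of j, and then the
    available vertices of that list are those with an unused number. *)
Lemma sum_avail_exp j : full_fold k H ->
  \sum_(c in left_transversals) #|avail c j| ^ n =
  \sum_(a : {ffun 'I_m -> 'I_k}) #|unused a| ^ n.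
Proof.
move=> fH; have [e eI eL] := @clist_enum _ H k (inr j) fH.1.
have eP b : e b \in L (inr j) by rewrite eL imset_f.
(* mu i b is the partner, in the list of i, of the vertex numbered b. *)
have muE i b : exists y, (y \in L (inl i)) && adj y (e b).
  have [//|y yi ey] := @partner_ex _ H k (inr j) (inl i) (e b) fH isT.
  by exists y; rewrite yi adj_sym.
pose mu i b := xchoose (muE i b).
have muL i b : mu i b \in L (inl i) by case/andP: (xchooseP (muE i b)).
have muA i b b' : adj (mu i b) (e b') = (b == b').
  have bb: adj (mu i b) (e b) by case/andP: (xchooseP (muE i b)).
  apply/idP/eqP => [bb'|<- //]; apply: eI.
  exact: (@partner_uniq _ H (inl i) (inr j) (mu i b)).
pose h (a : {ffun 'I_m -> 'I_k}) := [ffun i => mu i (a i)].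
have hI : injective h.
  move=> a a' /ffunP E; apply/ffunP => i; have := E i; rewrite !ffunE => Ei.
  by apply/eqP; rewrite -(muA i) Ei muA.
have hT : [set h a | a in predT] =i left_transversals.
  move=> c; apply/imsetP/familyP => [[a _ ->] i|cL]; first by rewrite ffunE muL.
  have ex i : exists b, adj (c i) (e b).
    have [//|y] := @partner_ex _ H k (inl i) (inr j) (c i) fH isT.
    by rewrite eL => /imsetP[b _ ->]; exists b.
  exists [ffun i => xchoose (ex i)] => //; apply/ffunP => i; rewrite !ffunE.
  set b := xchoose _; have cb : adj (c i) (e b) by exact: (xchooseP (ex i)).
  apply: (@partner_uniq _ H (inr j) (inl i) (e b)) => //; rewrite 1?adj_sym //.
  by rewrite muA.
rewrite -(eq_bigl _ _ hT) big_imset; last by move=> ? ? _ _; exact: hI.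
apply: eq_bigr => a _; congr (_ ^ _).
rewrite -(card_imset _ eI); apply: eq_card => y; rewrite inE.
apply/andP/imsetP => [[]|[b ba ->]].
  rewrite eL => /imsetP[b _ ->] /forallP bP; exists b => //; rewrite inE.
  by apply/imsetP => -[i _ E]; have := bP i; rewrite ffunE muA E eqxx.
split=> //; apply/forallP => i; rewrite ffunE muA.
by apply: contraTneq ba => <-; rewrite inE negbK imset_f.
Qed.

Lemma card_cover_colorings_le : 0 < n -> full_fold k H ->
  #|cover_colorings H| <= chrom_count (Kmn m n) k.
Proof.
move=> n0 fH; apply: leq_trans chrom_count_Kmn_ge.
apply: leq_trans card_cover_colorings_Kmn_le _.
rewrite -(leq_pmul2l n0) big_distrr /=.
apply: (@leq_trans (\sum_(c in left_transversals) \sum_j #|avail c j| ^ n)).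
  by apply: leq_sum => c _; exact: AGM_exp.
rewrite exchange_big /= (eq_bigr _ (fun j _ => sum_avail_exp j fH)).
by rewrite sum_nat_const card_ord.
Qed.

End CompleteBipartite.

(** * The canonical cover *)

(** The graph of a proper coloring is independent in the canonical cover. *)
Lemma chrom_count_le_std (G : sgraph) k (k0 : 0 < k) :
  chrom_count G k <= #|cover_colorings (std_cover G k0)|.
Proof.
pose h (f : {ffun G -> 'I_k}) : {set std_graph G k} := [set (v, f v) | v : G].
have hE f v b : ((v, b) \in h f) = (b == f v).
  by apply/imsetP/eqP => [[u _ [-> ->]] //|->]; exists v.
have hI : injective h.
  move=> f g /setP E; apply/ffunP => v; apply/eqP.
  by rewrite -hE -E hE.
rewrite /chrom_count -(card_imset _ hI); apply: subset_leq_card.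
apply/subsetP => _ /imsetP[f + ->]; rewrite !inE => /forallP fP.
apply/andP; split; last by rewrite card_imset // => u v [].
apply/forall_inP => _ /imsetP[u _ ->]; apply/forall_inP => _ /imsetP[v _ ->].
rewrite /adj /= /std_adj /= negb_or !negb_and negbK.
apply/andP; split; first by case: eqVneq => //= ->.
by have /forallP/(_ v) := fP u; case: (adj u v).
Qed.

Theorem theorem10 (m n k : nat) (hm : (0 < m)%N) (hn : (0 < n)%N) (hk : (0 < k)%N) :
  dual_DP (Kmn m n) k = chrom_count (Kmn m n) k.
Proof.
have [[H fH <-] maxH] := dual_DPP (Kmn m n) hk.
apply/eqP; rewrite eqn_leq card_cover_colorings_le //=.
apply: leq_trans (chrom_count_le_std _ hk) _.
by apply: maxH; exists (std_cover (Kmn m n) hk) => //; exact: std_full.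
Qed.
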